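(* Let $n\ge 1$, let $\tau>0$, let $K,M\in\mathbb{R}^{n\times n}$ be symmetric positive definite (stiffness and mass) matrices, and put $Z_\tau=\tau M^{-1}K$. Let $q=2$ and let $\mathcal{P}_L^{-1}\mathcal{A}\in\mathbb{R}^{2n\times 2n}$ be the preconditioned matrix of the two-stage Radau IIA method defined in the context. For $\mu\in(0,\infty)$ let $$f(\mu)=-\left(4\mu^{-1}+\frac23\mu+\frac{11}{3}\right)^{-1}.$$ Then the eigenvalues $\lambda$ and the eigenvectors $\bm{v}$ of $\mathcal{P}_L^{-1}\mathcal{A}$ have the following properties. 1. $\lambda=1$ is an eigenvalue with algebraic and geometric multiplicity equal to $n$. 2. The other eigenvalues are $1+f(\mu_\tau)\in[1-r_2^*,1)$, where $\mu_\tau$ is any eigenvalue of $Z_\tau$. Moreover the range of $f$ on $(0,\infty)$ is $[-r_2^*,0)$ with $$-r_2^*=-\frac{3\sqrt6}{11\sqrt6+24}=\min_{\mu\in(0,\infty)}f(\mu),$$ and $f(\mu)\to 0^-$ both as $\mu\to0^+$ and as $\mu\to+\infty$. 3. The eigenvectors related to $\lambda=1$ take the form $\bm{v}=\begin{bmatrix}\bm{v}_1\\ \bm{0}\end{bmatrix}$ for all (nonzero) vectors $\bm{v}_1$ of size $n$. The eigenvector associated with the eigenvalue $1+f(\mu_\tau)$ has the expression $$\bm{v}=\begin{bmatrix}-\frac13\left(1+4\mu_\tau^{-1}\right)\bm{v}_2\\ \bm{v}_2\end{bmatrix}$$ with $\bm{v}_2$ a nonzero vector such that $Z_\tau\bm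{v}_2=\mu_\tau\bm{v}_2$.
   Context: The two-stage Radau IIA Runge-Kutta matrix is $$A_2=\begin{bmatrix}\frac{5}{12}&-\frac1{12}\\ \frac34&\frac14\end{bmatrix}.$$ Its inverse is factorized as $A_2^{-1}=L_2U_2$ with $L_2$ lower triangular and $U_2$ upper triangular with unit diagonal; explicitly $$L_2=\begin{bmatrix}\frac32&0\\-\frac92&4\end{bmatrix},\qquad U_2=\begin{bmatrix}1&\frac13\\0&1\end{bmatrix}.$$ With $\otimes$ the Kronecker product and $I_2$ the identity matrix of order $2$, set $$\mathcal{A}=A_2^{-1}\otimes M+\tau I_2\otimes K,\qquad \mathcal{P}_L=L_2\otimes M+\tau I_2\otimes K .$$ Vectors in $\mathbb{C}^{2n}$ are written in block form with two blocks of size $n$.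
   Formalization: In part 3, that every eigenvector for 1+f(μ) has the displayed form is false if another eigenvalue ν of Z_τ has f(ν)=f(μ) (e.g. Z_τ=diag(1,6)); it is proved when μ is the only such eigenvalue, and otherwise eigenvectors are sums of displayed vectors over such ν. *)

(* Defs.v *)
From HB Require Import structures.
From mathcomp Require Import all_boot all_order all_algebra.
From mathcomp Require Import all_classical all_reals all_analysis.
From mathcomp Require Import mxtens complex.
From mathcomp Require Import ring lra.

Set Implicit Arguments.
Unset Strict Implicit.
Unset Printing Implicit Defensive.

Import Order.TTheory GRing.Theory Num.Theory.
Import numFieldNormedType.Exports.

Local Open Scope classical_set_scope.
Local Open Scope ring_scope.

(* MathComp's [eigenvalue] and [eigenspace] are about row vectors (left
   eigenvectors); the eigenvectors here are column vectors. *)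
Definition eigenvector (F : fieldType) (m : nat) (A : 'M[F]_m) (l : F)
    (v : 'cV[F]_m) : Prop :=
  v != 0 /\ A *m v = l *: v.

Definition is_eigenvalue (F : fieldType) (m : nat) (A : 'M[F]_m) (l : F) : Prop :=
  exists v : 'cV[F]_m, eigenvector A l v.

Definition alg_mult (F : fieldType) (m : nat) (A : 'M[F]_m) (l : F) : nat :=
  mup l (char_poly A).

(* The rows of [eigenspace A^T l] span the transposes of the column vectors v
   with A v = l v. *)
Definition geo_mult (F : fieldType) (m : nat) (A : 'M[F]_m) (l : F) : nat :=
  \rank (eigenspace A^T l).

Definition sym_posdef (R : realType) (n : nat) (A : 'M[R]_n) : Prop :=
  A^T = A /\ forall x : 'cV[R]_n, x != 0 -> 0 < (x^T *m A *m x) 0 0.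

Definition mx2 (T : Type) (a b c d : T) : 'M[T]_2 :=
  \matrix_(i, j) if i == 0 then (if j == 0 then a else b)
                 else (if j == 0 then c else d).

Definition radauA2 (R : realType) : 'M[R]_2 :=
  mx2 (5 / 12) (- (1 / 12)) (3 / 4) (1 / 4).

Definition radauL2 (R : realType) : 'M[R]_2 := mx2 (3 / 2) 0 (- (9 / 2)) 4.

Definition radauU2 (R : realType) : 'M[R]_2 := mx2 1 (1 / 3) 0 1.

Lemma invmx_radauA2 (R : realType) :
  radauA2 R \in unitmx /\ invmx (radauA2 R) = radauL2 R *m radauU2 R.
Proof.
have H : radauA2 R *m (radauL2 R *m radauU2 R) = 1%:M.
  apply/matrixP => i j; rewrite !mxE !big_ord_recl big_ord0 !mxE /=.
  rewrite !big_ord_recl !big_ord0 !mxE /=.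
  by case: i => [[|[|//]] ?]; case: j => [[|[|//]] ?]; rewrite /=; field.
have [uA _] := mulmx1_unit H.
by split=> //; rewrite -[LHS]mulmx1 -H mulKmx.
Qed.

Definition calA (R : realType) (n : nat) (tau : R) (K M : 'M[R]_n) :
    'M[R]_(2 * n) :=
  tensmx (invmx (radauA2 R)) M + tau *: tensmx (1%:M : 'M[R]_2) K.

Definition calPL (R : realType) (n : nat) (tau : R) (K M : 'M[R]_n) :
    'M[R]_(2 * n) :=
  tensmx (radauL2 R) M + tau *: tensmx (1%:M : 'M[R]_2) K.

(* Both real matrices below are viewed over R[i], where their eigenvalues and
   eigenvectors live. *)
Definition prec (R : realType) (n : nat) (tau : R) (K M : 'M[R]_n) :
    'M[R[i]]_(2 * n) :=
  map_mx (real_complex R) (invmx (calPL tau K M) *m calA tau K M).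

Definition Ztau (R : realType) (n : nat) (tau : R) (K M : 'M[R]_n) :
    'M[R[i]]_n :=
  map_mx (real_complex R) (tau *: (invmx M *m K)).

(* The block column [v1; v2], with the block indexing used by [tensmx]. *)
Definition block_vec (T : Type) (n : nat) (v1 v2 : 'cV[T]_n) : 'cV[T]_(2 * n) :=
  \col_k (if (mxtens_unindex k).1 == 0 then v1 else v2) (mxtens_unindex k).2 0.

Definition f2 (R : realType) (mu : R) : R :=
  - (4 * mu^-1 + 2 / 3 * mu + 11 / 3)^-1.

Definition r2star (R : realType) : R :=
  3 * Num.sqrt 6 / (11 * Num.sqrt 6 + 24).

Definition radau_vec (R : realType) (n : nat) (mu : R) (v2 : 'cV[R[i]]_n) :
    'cV[R[i]]_(2 * n) :=
  block_vec (real_complex R (- (1 / 3) * (1 + 4 * mu^-1)) *: v2) v2.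

(* Main.v *)
Require Import Defs.
From HB Require Import structures.
From mathcomp Require Import all_boot all_order all_algebra.
From mathcomp Require Import all_classical all_reals all_analysis.
From mathcomp Require Import mxtens complex.
From mathcomp Require Import ring lra.

Set Implicit Arguments.
Unset Strict Implicit.
Unset Printing Implicit Defensive.

Import Order.TTheory GRing.Theory Num.Theory.
Import numFieldNormedType.Exports.

Local Open Scope classical_set_scope.
Local Open Scope ring_scope.

(* For t = 1 - lambda, the equation P_L^-1 A v = lambda v reads A v = lambda P_L v
   in blocks; multiplying by M^-1 leaves two equations in v1, v2 and Z = Z_tau
   only.  If t = 0 they say v2 = 0.  Otherwise they are equivalent to
   3 Z v1 + 4 v2 + Z v2 = 0 and v2 = -2 t (3/2 v1 + Z v1), which determine v1
   from v2 and force the quadratic equation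
   Z^2 v2 = (3 / (2 t) - 11 / 2) Z v2 - 6 v2.  Factoring this quadratic over C
   gives an eigenvalue mu of Z with 1 / t = 4 / mu + 2 mu / 3 + 11 / 3, that is
   lambda = 1 + f(mu), and splits v2 into eigenvectors of Z for mu and 6 / mu;
   when mu^2 = 6 the double root does no harm because Z is self-adjoint for the
   inner product of M. *)

(** * The scalar function [f2]: minimum, range and limits *)

Section RadauFunction.
Variable R : realType.
Implicit Types mu nu : R.

Local Notation s := (Num.sqrt 6 : R).

Let sqr_s : s ^+ 2 = 6. Proof. by rewrite sqr_sqrtr// ler0n. Qed.
Let s_gt0 : 0 < s. Proof. by rewrite sqrtr_gt0 ltr0n. Qed.

Lemma r2starE : r2star R = (11 / 3 + 4 / 3 * s)^-1.
Proof.
rewrite /r2star; field: sqr_s.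
by apply/andP; split; apply: lt0r_neq0; move: s_gt0; lra.
Qed.

(** Completing the square in [2 / 3 * (mu + 6 / mu)]: the remainder vanishes exactly at [mu = s],
    which locates the minimum of [f2]. *)
Lemma f2_denominatorE mu : mu != 0 ->
  4 * mu^-1 + 2 / 3 * mu + 11 / 3 =
  11 / 3 + 4 / 3 * s + 2 / 3 * ((mu - s) ^+ 2 / mu).
Proof. by move=> mu0; field: sqr_s. Qed.

Lemma f2_denominator_gt0 mu : 0 < mu -> 0 < 4 * mu^-1 + 2 / 3 * mu + 11 / 3.
Proof. by move=> mu0; have := mu0; rewrite -invr_gt0; lra. Qed.

Lemma f2_lt0 mu : 0 < mu -> f2 mu < 0.
Proof. by move=> mu0; rewrite /f2 oppr_lt0 invr_gt0 f2_denominator_gt0. Qed.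

Lemma f2_ge mu : 0 < mu -> - r2star R <= f2 mu.
Proof.
move=> mu0; rewrite /f2 r2starE lerN2 lef_pV2 ?posrE ?f2_denominator_gt0//.
rewrite f2_denominatorE ?gt_eqF// lerDl mulr_ge0 ?divr_ge0 ?sqr_ge0 ?ler0n//.
exact: ltW.
Qed.

Lemma f2_sqrt6 : f2 s = - r2star R.
Proof.
rewrite /f2 r2starE f2_denominatorE ?gt_eqF// subrr expr0n/= mul0r mulr0.
by rewrite addr0.
Qed.

Lemma image_f2 : @f2 R @` `]0, +oo[ = `[- r2star R, 0[%classic.
Proof.
apply/seteqP; split => [_ [mu/= + <-]|y /=]; rewrite in_itv/=.
  by rewrite andbT => mu0; rewrite in_itv/= f2_ge// f2_lt0.
move=> /andP[ry y0].
(* [f2 mu = y] amounts to [mu + 6 / mu = b], so the preimage chosen below is the larger root of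
   [X^2 - b X + 6]. *)
pose b := 3 / 2 * ((- y)^-1 - 11 / 3).
have ny0 : 0 < - y by rewrite oppr_gt0.
have sb : 2 * s <= b.
  suff : 11 / 3 + 4 / 3 * s <= (- y)^-1 by rewrite /b; lra.
  rewrite -[leLHS]invrK -r2starE lef_pV2 ?posrE//; first by rewrite lerNl.
  rewrite r2starE invr_gt0; move: s_gt0; lra.
have disc_ge0 : 0 <= b ^+ 2 - 24.
  by rewrite subr_ge0; move: sqr_s s_gt0 sb; nra.
pose mu := (b + Num.sqrt (b ^+ 2 - 24)) / 2.
have mu0 : 0 < mu.
  rewrite divr_gt0 ?ltr0n// ltr_wpDr ?sqrtr_ge0//.
  by apply: lt_le_trans sb; rewrite mulr_gt0 ?ltr0n.
exists mu; first by rewrite /= in_itv/= mu0.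
have quad : mu ^+ 2 + 6 = b * mu.
  have := sqr_sqrtr disc_ge0; rewrite /mu; set r := Num.sqrt _ => rE.
  by field: rE.
rewrite /f2; suff -> : 4 * mu^-1 + 2 / 3 * mu + 11 / 3 = (- y)^-1.
  by rewrite invrK opprK.
rewrite -[RHS](_ : 2 / 3 * b + 11 / 3 = _); last first.
  by rewrite /b; field; rewrite lt_eqF.
have -> : b = (mu ^+ 2 + 6) / mu by rewrite quad mulfK// gt_eqF.
by field; rewrite gt_eqF.
Qed.

(** The term [4 * mu^-1] dominates the denominator near 0; this crude bound gives the limit
    there. *)
Lemma normr_f2_le_mul mu : 0 < mu -> `|f2 mu| <= mu.
Proof.
move=> mu0; rewrite /f2 normrN gtr0_norm ?invr_gt0 ?f2_denominator_gt0//.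
rewrite -[leRHS]invrK lef_pV2 ?posrE ?invr_gt0 ?f2_denominator_gt0//.
by have := mu0; rewrite -invr_gt0; lra.
Qed.

(** The term [2 / 3 * mu] gives the analogous bound for the limit at infinity. *)
Lemma normr_f2_le_inv mu : 0 < mu -> `|f2 mu| <= 2 * mu^-1.
Proof.
move=> mu0; rewrite /f2 normrN gtr0_norm ?invr_gt0 ?f2_denominator_gt0//.
rewrite -[leRHS]invrK lef_pV2 ?posrE ?invr_gt0 ?f2_denominator_gt0 ?mulr_gt0//
  ?invr_gt0//.
by rewrite invfM invrK; have := mu0; rewrite -invr_gt0; lra.
Qed.

Lemma cvg_at_left0 {T : Type} {F : set_system T} {FF : Filter F} (f : T -> R) :
  (forall e, 0 < e -> \forall x \near F, `|f x| < e) ->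
  (\forall x \near F, f x < 0) -> f x @[x --> F] --> 0^'-.
Proof.
move=> fe f0 A /= [e/= e0 eA].
have := fe _ e0; apply: filter_app; move: f0; apply: filter_app.
by near=> x => fx0 fxe; apply: eA => //=; rewrite sub0r normrN.
Unshelve. all: by end_near. Qed.

Lemma f2_cvg_right0 : f2 mu @[mu --> (0 : R)^'+] --> (0 : R)^'-.
Proof.
apply: cvg_at_left0 => [e e0|]; near=> mu; last first.
  by apply: f2_lt0; near: mu; exact: nbhs_right_gt.
have mu0 : 0 < mu by near: mu; exact: nbhs_right_gt.
by apply: le_lt_trans (normr_f2_le_mul mu0) _; near: mu; exact: nbhs_right_lt.
Unshelve. all: by end_near. Qed.

Lemma f2_cvg_pinfty : f2 mu @[mu --> +oo%R] --> (0 : R)^'-.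
Proof.
apply: cvg_at_left0 => [e e0|]; near=> mu; last first.
  by apply: f2_lt0; near: mu; exact/nbhs_pinfty_gt/num_real.
have mu0 : 0 < mu by near: mu; exact/nbhs_pinfty_gt/num_real.
apply: le_lt_trans (normr_f2_le_inv mu0) _; rewrite ltr_pdivrMr// mulrC.
by rewrite -ltr_pdivrMr//; near: mu; exact/nbhs_pinfty_gt/num_real.
Unshelve. all: by end_near. Qed.

End RadauFunction.

(** * Two-by-two matrices, block columns and Kronecker products *)

Lemma ord2P (i : 'I_2) : i = 0 \/ i = 1.
Proof. by case: i => [[|[|//]]] i2; [left|right]; exact: val_inj. Qed.

Lemma map_mx2 (T U : Type) (f : T -> U) a b c d :
  map_mx f (mx2 a b c d) = mx2 (f a) (f b) (f c) (f d).
Proof. by apply/matrixP => i j; rewrite !mxE; do 2?case: ifP. Qed.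

Lemma mx2_scalar1 (F : pzRingType) : 1%:M = mx2 1 0 0 1 :> 'M[F]_2.
Proof.
apply/matrixP => i j; rewrite !mxE.
by case: (ord2P i) => ->; case: (ord2P j) => ->.
Qed.

Section BlockVectors.
Variables (F : fieldType) (n : nat).
Implicit Types (v w : 'cV[F]_n) (A : 'M[F]_n).

Lemma block_vecE v1 v2 (i : 'I_2) (j : 'I_n) (k : 'I_1) :
  block_vec v1 v2 (mxtens_index (i, j)) k = if i == 0 then v1 j 0 else v2 j 0.
Proof. by rewrite mxE mxtens_indexK/=; case: ifP. Qed.

Lemma block_vec_surj (x : 'cV[F]_(2 * n)) : exists v1 v2, x = block_vec v1 v2.
Proof.
exists (\col_j x (mxtens_index (0, j)) 0), (\col_j x (mxtens_index (1, j)) 0).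
apply/colP => k; rewrite -[k]mxtens_unindexK.
case: (mxtens_unindex k) => i j; rewrite block_vecE !mxE.
by case: (ord2P i) => ->.
Qed.

Lemma block_vec_inj v1 v2 w1 w2 :
  block_vec v1 v2 = block_vec w1 w2 -> v1 = w1 /\ v2 = w2.
Proof.
move=> /colP vw; split; apply/colP => j.
  by have := vw (mxtens_index (0, j)); rewrite !block_vecE.
by have := vw (mxtens_index (1, j)); rewrite !block_vecE.
Qed.

Lemma block_vec0 : block_vec 0 0 = 0 :> 'cV[F]_(2 * n).
Proof. by apply/colP => k; rewrite !mxE; case: ifP; rewrite mxE. Qed.

Lemma block_vecD v1 v2 w1 w2 :
  block_vec v1 v2 + block_vec w1 w2 = block_vec (v1 + w1) (v2 + w2).
Proof. by apply/colP => k; rewrite !mxE; case: ifP => _; rewrite !mxE. Qed.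

Lemma block_vecZ a v1 v2 :
  a *: block_vec v1 v2 = block_vec (a *: v1) (a *: v2).
Proof. by apply/colP => k; rewrite !mxE; case: ifP => _; rewrite !mxE. Qed.

Lemma block_vec_eq0 v1 v2 : (block_vec v1 v2 == 0) = (v1 == 0) && (v2 == 0).
Proof.
apply/eqP/andP => [|[/eqP-> /eqP->]]; last exact: block_vec0.
by rewrite -block_vec0 => /block_vec_inj[-> ->].
Qed.

Lemma tensmx_block_vec (B : 'M[F]_2) A v1 v2 :
  tensmx B A *m block_vec v1 v2 =
  block_vec (A *m (B 0 0 *: v1 + B 0 1 *: v2)) (A *m (B 1 0 *: v1 + B 1 1 *: v2)).
Proof.
apply/colP => k; rewrite -[k]mxtens_unindexK; case: (mxtens_unindex k) => i j.
(* Indexing the sum by pairs lets it split into one sum per block. *)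
rewrite block_vecE mxE (reindex (@mxtens_index 2 n)) /=; last first.
  by exists (@mxtens_unindex 2 n) => p _; rewrite ?mxtens_indexK ?mxtens_unindexK.
transitivity (\sum_(p : 'I_2 * 'I_n) B i p.1 * A j p.2 *
  (if p.1 == 0 then v1 p.2 0 else v2 p.2 0)).
  by apply: eq_bigr => -[p q] _; rewrite tensmxE block_vecE.
rewrite -(pair_bigA _ (fun p q => B i p * A j q *
  (if p == 0 then v1 q 0 else v2 q 0)))/=.
rewrite big_ord_recl big_ord1/= -big_split/=.
have -> : lift ord0 ord0 = 1 :> 'I_2 by exact: val_inj.
by case: (ord2P i) => -> /=; rewrite mxE; apply: eq_bigr => q _;
  rewrite !mxE mulrDr; congr (_ + _); rewrite mulrCA mulrA.
Qed.

Lemma tensmx_mx2_block_vec a b c d A v1 v2 :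
  tensmx (mx2 a b c d) A *m block_vec v1 v2 =
  block_vec (A *m (a *: v1 + b *: v2)) (A *m (c *: v1 + d *: v2)).
Proof.
by rewrite tensmx_block_vec; congr block_vec; rewrite ![mx2 _ _ _ _ _ _]mxE.
Qed.

(** The tensor index of [(i, j)] is [i * n + j], the order used by [col_mx]; hence block-matrix
    calculus becomes available after a cast. *)
Lemma block_vec_castmx (e : (n + n = 2 * n)%N) v1 v2 :
  block_vec v1 v2 = castmx (e, erefl) (col_mx v1 v2).
Proof.
apply/colP => k; rewrite -[k]mxtens_unindexK.
case: (mxtens_unindex k) => i j; rewrite block_vecE castmxE.
case: (ord2P i) => -> /=.
  rewrite [X in col_mx _ _ X](_ : _ = lshift n j); last exact: val_inj.
  by rewrite col_mxEu; congr (v1 j _); exact: val_inj.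
rewrite [X in col_mx _ _ X](_ : _ = rshift n j).
  by rewrite col_mxEd; congr (v2 j _); exact: val_inj.
by apply: val_inj; rewrite /= mul1n.
Qed.

End BlockVectors.

Lemma scaleC (F : comPzRingType) (V : lmodType F) (a b : F) (v : V) :
  a *: (b *: v) = b *: (a *: v).
Proof. by rewrite !scalerA mulrC. Qed.

(** * Column eigenvectors and multiplicities *)

Section Multiplicities.
Variable F : fieldType.

Lemma eigenvalue_trmxP m (A : 'M[F]_m) l :
  reflect (is_eigenvalue A l) (eigenvalue A^T l).
Proof.
apply: (iffP eigenvalueP) => [[v vA v0]|[v [v0 Av]]].
  exists v^T; split; first by rewrite trmx_eq0.
  by rewrite -[A]trmxK -trmx_mul vA linearZ.
by exists v^T; rewrite ?trmx_eq0// -trmx_mul Av linearZ.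
Qed.

Lemma char_poly_trmx m (A : 'M[F]_m) : char_poly A^T = char_poly A.
Proof.
by rewrite /char_poly -det_tr /char_poly_mx linearB/= tr_scalar_mx map_trmx trmxK.
Qed.

Lemma is_eigenvalue_root m (A : 'M[F]_m) l :
  is_eigenvalue A l <-> root (char_poly A) l.
Proof.
rewrite -char_poly_trmx -eigenvalue_root_char.
by split => /eigenvalue_trmxP.
Qed.

Lemma unitmx_ker0 m (A : 'M[F]_m) :
  (forall v : 'cV[F]_m, A *m v = 0 -> v = 0) -> A \in unitmx.
Proof.
move=> A0; rewrite -unitmx_tr -row_free_unit; apply: inj_row_free => v vA.
by apply: trmx_inj; rewrite trmx0; apply: A0; rewrite -[A]trmxK -trmx_mul vA trmx0.
Qed.

(** The characteristic polynomial factors as [('X - l)^p] times that of [S], which does not vanish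
    at [l]. *)
Lemma mup_char_poly_block p q l (B : 'M[F]_(p, q)) (S : 'M[F]_q) :
  ~ is_eigenvalue S l -> mup l (char_poly (block_mx l%:M B 0 S)) = p.
Proof.
move=> /is_eigenvalue_root/negP Sl.
rewrite /char_poly /char_poly_mx map_block_mx map_scalar_mx map_mx0.
rewrite [X in X - _]scalar_mx_block opp_block_mx add_block_mx subr0 sub0r.
rewrite det_ublock -raddfB /= det_scalar.
by rewrite mupMl// mup_XsubCX eqxx.
Qed.

Lemma char_poly_castmx m m' (e : m = m') (A : 'M[F]_m) :
  char_poly (castmx (e, e) A) = char_poly A.
Proof. by case: _ / e. Qed.

Lemma castmx_mulmx_col m m' (e : m = m') (A : 'M[F]_m) (v : 'cV[F]_m) :
  castmx (e, e) A *m castmx (e, erefl) v = castmx (e, erefl) (A *m v).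
Proof. by case: _ / e. Qed.

(** The first hypothesis makes [A] block upper triangular with upper left block [l%:M]; the second
    says that [l] is not an eigenvalue of the lower right block. *)
Lemma alg_mult_block_vec n (A : 'M[F]_(2 * n)) l :
  (forall v, A *m block_vec v 0 = l *: block_vec v 0) ->
  (forall u v, A *m block_vec 0 v = block_vec u (l *: v) -> v = 0) ->
  alg_mult A l = n.
Proof.
move=> Al Av0; have e : (2 * n = n + n)%N by rewrite mul2n addnn.
set A' := castmx (e, e) A.
have A'E (v1 v2 w1 w2 : 'cV_n) :
    A' *m col_mx v1 v2 = col_mx w1 w2 <->
    A *m block_vec v1 v2 = block_vec w1 w2.
  have colE (x y : 'cV[F]_n) :
      col_mx x y = castmx (e, erefl 1%N) (block_vec x y).
    by rewrite (block_vec_castmx (esym e)) (castmxKV e (erefl 1%N)).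
  rewrite !colE castmx_mulmx_col; split => [|-> //].
  exact: (can_inj (castmxK e (erefl 1%N))).
have A'l (v : 'cV_n) : A' *m col_mx v 0 = col_mx (l *: v) 0.
  by apply/A'E; rewrite Al block_vecZ scaler0.
have [ul dl] : ulsubmx A' = l%:M /\ dlsubmx A' = 0.
  split; apply/matrixP => i j.
    have := A'l (delta_mx j 0); rewrite -[A' in LHS]submxK mul_block_col.
    rewrite !mulmx0 !addr0 => /eq_col_mx[/colP/(_ i) + _].
    rewrite -colE => Aij; rewrite mxE in Aij.
    by rewrite Aij !mxE eqxx andbT mulr_natr.
  have := A'l (delta_mx j 0); rewrite -[A' in LHS]submxK mul_block_col.
  rewrite !mulmx0 !addr0 => /eq_col_mx[_ /colP/(_ i)].
  by rewrite -colE => Aij; rewrite mxE [RHS]mxE in Aij; rewrite Aij mxE.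
rewrite /alg_mult -(char_poly_castmx e) -/A' -[A']submxK ul dl.
apply: mup_char_poly_block => -[w [/eqP w0 Sw]]; apply: w0.
apply: (Av0 (ursubmx A' *m w)); apply/A'E.
by rewrite -[in LHS](submxK A') mul_block_col !mulmx0 !add0r Sw.
Qed.

(** The rows of [E] below are independent and span the same row space as the eigenspace of [A^T]. *)
Lemma geo_mult_block_vec n (A : 'M[F]_(2 * n)) l :
  (forall x, A *m x = l *: x <-> exists v, x = block_vec v 0) ->
  geo_mult A l = n.
Proof.
move=> Al.
pose E : 'M[F]_(n, 2 * n) := \matrix_i (block_vec (delta_mx i 0) 0)^T.
have vE (v : 'rV_n) : v *m E = (block_vec v^T 0)^T.
  apply/rowP => k; rewrite mulmx_sum_row summxE !mxE.
  under eq_bigr do rewrite rowK !mxE.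
  case: ifP => _; last by rewrite big1 ?mxE// => i _; rewrite mulr0.
  rewrite mxE (bigD1 (mxtens_unindex k).2)//= mxE !eqxx mulr1 big1 ?addr0//.
  by move=> i /negPf ik; rewrite mxE eq_sym ik mulr0.
have /eqP rankE : row_free E.
  apply: inj_row_free => v; rewrite vE => /eqP.
  by rewrite trmx_eq0 block_vec_eq0 trmx_eq0 => /andP[/eqP].
rewrite -[RHS]rankE /geo_mult; apply: eqmx_rank.
apply/andP; split; apply/row_subP => i.
  have /eigenspaceP := row_sub i (eigenspace A^T l).
  move=> /(congr1 trmx); rewrite trmx_mul trmxK linearZ/= => /Al[v vE'].
  rewrite -[row _ _]trmxK vE' -[v]trmxK -vE; exact: submxMl.
apply/eigenspaceP; rewrite rowK -trmx_mul; apply: trmx_inj.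
by rewrite trmxK linearZ/= trmxK; apply/Al; exists (delta_mx i 0).
Qed.

End Multiplicities.

(** * Elimination in the block eigenvalue equations *)

Section RadauEquations.
Variables (F : numFieldType) (n : nat).
Implicit Types (t m : F) (v z : 'cV[F]_n).

(** A certificate: once the coefficients of a linear combination of known equations are supplied,
    [field] checks the rest. Shorter combinations are padded with coefficient 0. *)
Lemma eq_lincomb (c1 c2 c3 x1 y1 x2 y2 x3 y3 x y : F) :
  x1 = y1 -> x2 = y2 -> x3 = y3 ->
  x - y = c1 * (x1 - y1) + c2 * (x2 - y2) + c3 * (x3 - y3) -> x = y.
Proof.
move=> -> -> ->; rewrite !subrr !mulr0 !addr0 => /eqP.
by rewrite subr_eq0 => /eqP.
Qed.

(** Here [z1], [z2] stand for [Z v1], [Z v2]. Adding three times the first equation to the second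
    cancels [v1], and a factor [t] can then be divided out. *)
Lemma radau_eqsP t v1 v2 z1 z2 : t != 0 ->
  (3 / 2 *: v1 + 1 / 2 *: v2 + z1 = (1 - t) *: (3 / 2 *: v1 + z1) /\
   - (9 / 2) *: v1 + 5 / 2 *: v2 + z2 =
     (1 - t) *: (- (9 / 2) *: v1 + 4 *: v2 + z2)) <->
  (3 *: z1 + 4 *: v2 + z2 = 0 /\ v2 = (- 2 * t) *: (3 / 2 *: v1 + z1)).
Proof.
move=> t0; split=> -[/colP e1 /colP e2]; split; apply/colP => i;
  move: {e1 e2}(e1 i) (e2 i); rewrite !mxE;
  move: (v1 i 0) (v2 i 0) (z1 i 0) (z2 i 0) => a b c d e1 e2.
- by apply: (eq_lincomb (c1 := 3 / t) (c2 := t^-1) (c3 := 0) e1 e2 e1); field.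
- by apply: (eq_lincomb (c1 := 2) (c2 := 0) (c3 := 0) e1 e1 e1); field.
- by apply: (eq_lincomb (c1 := 1 / 2) (c2 := 0) (c3 := 0) e2 e2 e2); field.
- by apply: (eq_lincomb (c1 := t) (c2 := - (3 / 2)) (c3 := 0) e1 e2 e1); field.
Qed.

(** Combining the first equation with the images of both under [Z] cancels [Z v1] and [Z^2 v1]. *)
Lemma radau_quadratic t (Z : 'M[F]_n) v1 v2 : t != 0 ->
  3 *: (Z *m v1) + 4 *: v2 + Z *m v2 = 0 ->
  v2 = (- 2 * t) *: (3 / 2 *: v1 + Z *m v1) ->
  Z *m (Z *m v2) = (3 / (2 * t) - 11 / 2) *: (Z *m v2) - 6 *: v2.
Proof.
move=> t0 e1 e2; have := congr1 (mulmx Z) e2; have := congr1 (mulmx Z) e1.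
rewrite !mulmxDr mulmx0 -!scalemxAr !mulmxDr -!scalemxAr.
move: e1 {e2}; move: (Z *m (Z *m v1)) (Z *m (Z *m v2)) (Z *m v1) (Z *m v2).
move=> zz1 zz2 z1 z2 /colP e1 /colP e2 /colP e3; apply/colP => i.
move: {e1 e2 e3}(e1 i) (e2 i) (e3 i); rewrite !mxE.
move: (zz1 i 0) (zz2 i 0) (z1 i 0) (z2 i 0) (v2 i 0) => c' d' c d b e1 e2 e3.
by apply: (eq_lincomb (c1 := 3 / 2) (c2 := 1) (c3 := - (3 / (2 * t))) e1 e2 e3);
  field.
Qed.

(** The first equation is what fixes the coefficient of [u]; for that [u] the second one becomes the
    relation between [t] and [m]. *)
Lemma radau_eqs_eigenvector t m v : t != 0 -> m != 0 ->
  t^-1 = 4 * m^-1 + 2 / 3 * m + 11 / 3 ->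
  let u := (- (1 / 3) * (1 + 4 * m^-1)) *: v in
  3 *: (m *: u) + 4 *: v + m *: v = 0 /\
  v = (- 2 * t) *: (3 / 2 *: u + m *: u).
Proof.
move=> t0 m0 tE u; split; apply/colP => i; rewrite !mxE.
  by move: (v i 0) => a; field.
move: (v i 0) => a.
apply: (eq_lincomb (c1 := t * a) (c2 := 0) (c3 := 0) tE tE tE).
by field; rewrite m0.
Qed.

End RadauEquations.

(** * Real positive definite matrices acting on complex vectors *)

Section PosdefOverC.
Variables (R : realType) (n : nat).
Implicit Types A : 'M[R]_n.
Local Notation C := R[i].
Local Notation toC := (real_complex R).
Local Notation toCmx := (map_mx toC).

Lemma complex_mxE m p (X : 'M[C]_(m, p)) :
  exists a b : 'M[R]_(m, p), X = toCmx a + 'i%C *: toCmx b.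
Proof.
exists (map_mx (@complex.Re R) X), (map_mx (@complex.Im R) X).
by apply/matrixP => i j; rewrite !mxE; case: (X i j) => a b /=; simpc.
Qed.

(** For [x = a + i b] symmetry cancels the cross terms, leaving [a^T A a + b^T A b], where [a] or
    [b] is nonzero. *)
Lemma posdef_hermitian A (x : 'cV[C]_n) : sym_posdef A -> x != 0 ->
  exists2 h : R, 0 < h & ((map_mx conjc x)^T *m toCmx A *m x) 0 0 = toC h.
Proof.
move=> [Asym Apos]; have [a [b ->]] := complex_mxE x => x0.
pose q (u v : 'cV[R]_n) := (u^T *m A *m v) 0 0.
have qC u v : (toCmx u)^T *m toCmx A *m toCmx v = (toC (q u v))%:M.
  by rewrite map_trmx -!map_mxM [LHS]mx11_scalar mxE.
have qsym : q a b = q b a.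
  rewrite /q -[LHS](_ : (a^T *m A *m b)^T 0 0 = _); last by rewrite mxE.
  by rewrite !trmx_mul trmxK Asym mulmxA.
have q_ge0 u : 0 <= q u u.
  have [->|/Apos/ltW//] := eqVneq u 0.
  by rewrite /q mulmx0 mxE.
exists (q a a + q b b).
  have [a0|a0] := eqVneq a 0; last exact: ltr_wpDr (q_ge0 b) (Apos _ a0).
  apply: ltr_wpDl (q_ge0 a) (Apos _ _); apply: contraNneq x0 => b0.
  by rewrite a0 b0 !map_mx0 scaler0 addr0.
have -> : map_mx conjc (toCmx a + 'i%C *: toCmx b) =
          toCmx a - 'i%C *: toCmx b.
  by apply/matrixP => i j; rewrite !mxE; simpc.
rewrite linearB/= linearZ/= !(mulmxDl, mulmxDr, mulNmx, mulmxN).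
rewrite -!(scalemxAl, scalemxAr) !scalerA !qC qsym.
by rewrite addrA subrK -expr2 sqr_i scaleN1r opprK -raddfD/= mxE mulr1n -rmorphD.
Qed.

End PosdefOverC.

(** * Spectral properties of [Ztau] *)

Section Radau.
Variables (R : realType) (n : nat) (tau : R) (K M : 'M[R]_n).
Hypotheses (tau_gt0 : 0 < tau) (Kpos : sym_posdef K) (Mpos : sym_posdef M).
Local Notation C := R[i].
Local Notation toC := (real_complex R).
Local Notation toCmx := (map_mx toC).
Local Notation Z := (Ztau tau K M).
Local Notation PA := (prec tau K M).

Lemma posdef_unitmx (A : 'M[R]_n) : sym_posdef A -> A \in unitmx.
Proof.
move=> [_ Apos]; apply: unitmx_ker0 => v Av; apply/eqP; apply: contraT => /Apos.
by rewrite -mulmxA Av mulmx0 mxE ltxx.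
Qed.

Let uM : M \in unitmx := posdef_unitmx Mpos.
Let uMC : toCmx M \in unitmx. Proof. by rewrite map_unitmx. Qed.

Lemma mulM_Ztau : toCmx M *m Z = toC tau *: toCmx K.
Proof. by rewrite /Ztau -map_mxM -scalemxAr mulKVmx// map_mxZ. Qed.

(** Rayleigh quotient: pairing [M Z x = tau K x] with the conjugate of [x] gives [mu] as a ratio of
    positive reals. *)
Lemma Ztau_eigenvalue_gt0 (mu : C) :
  is_eigenvalue Z mu -> exists2 m : R, 0 < m & mu = toC m.
Proof.
move=> [x [x0 Zx]].
have [hM hM0 hME] := posdef_hermitian Mpos x0.
have [hK hK0 hKE] := posdef_hermitian Kpos x0.
exists (tau * hK / hM); first by rewrite divr_gt0 ?mulr_gt0.
have : toCmx M *m (Z *m x) = toC tau *: (toCmx K *m x).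
  by rewrite mulmxA mulM_Ztau -scalemxAl.
rewrite Zx -scalemxAr => /(congr1 (fun y => ((map_mx conjc x)^T *m y) 0 0)).
rewrite -!scalemxAr !mulmxA [LHS]mxE [RHS]mxE hME hKE => e.
have hMC0 : toC hM != 0 by rewrite fmorph_eq0 gt_eqF.
by apply: (mulIf hMC0); rewrite e -!rmorphM/= divfK ?gt_eqF.
Qed.

Lemma Ztau_eigenvalue_real_gt0 (mu : R) : is_eigenvalue Z (toC mu) -> 0 < mu.
Proof. by move=> /Ztau_eigenvalue_gt0[m m0 /complexI->]. Qed.

(* [M (Z - mu)] is real symmetric, so with [u = (Z - mu) x] one gets
   [u^* M u = u^* M (Z - mu) x = (M (Z - mu) u)^* x = 0]. *)
Lemma Ztau_semisimple (mu : R) (x : 'cV[C]_n) :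
  let u := Z *m x - toC mu *: x in Z *m u = toC mu *: u -> u = 0.
Proof.
move=> u Zu; apply/eqP; apply: contraT => u0.
have [h h0 hE] := posdef_hermitian Mpos u0.
pose S := tau *: K - mu *: M.
have MZ v : toCmx M *m (Z *m v - toC mu *: v) = toCmx S *m v.
  rewrite mulmxBr mulmxA mulM_Ztau map_mxB !map_mxZ mulmxBl -!scalemxAl.
  by rewrite -scalemxAr.
have Su : toCmx S *m u = 0 by rewrite -MZ Zu subrr mulmx0.
have Ssym : S^T = S.
  by rewrite /S linearB/= !linearZ/= (proj1 Kpos) (proj1 Mpos).
have uS : (map_mx conjc u)^T *m toCmx S = 0.
  apply: trmx_inj; rewrite trmx_mul trmxK map_trmx Ssym trmx0.
  have -> : toCmx S = map_mx conjc (toCmx S).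
    by apply/matrixP => i j; rewrite !mxE/=; simpc.
  by rewrite -map_mxM Su map_mx0.
move: hE; rewrite -mulmxA {2}/u MZ mulmxA uS mul0mx mxE => /esym/eqP.
by rewrite fmorph_eq0 gt_eqF.
Qed.

(** * Block action of [calA], [calPL] and [prec] *)

Lemma radauL2U2 : radauL2 R *m radauU2 R = mx2 (3 / 2) (1 / 2) (- (9 / 2)) (5 / 2).
Proof.
apply/matrixP => i j; rewrite !mxE big_ord_recl big_ord1 !mxE.
by case: (ord2P i) => ->; case: (ord2P j) => -> /=; field.
Qed.

Lemma toC_radau_coeffs :
  ((toC (3 / 2) = 3 / 2) * (toC (1 / 2) = 1 / 2) * (toC (5 / 2) = 5 / 2) *
   (toC (- (9 / 2)) = - (9 / 2)) * (toC 4 = 4))%type.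
Proof.
by do !split; rewrite ?rmorphN ?rmorphM/= ?fmorphV ?rmorph1 ?rmorph_nat.
Qed.

(** Writing [tau K] as [M Z] puts a factor [M] in front of every block, to be cancelled later. *)
Lemma tau_tensmx_block_vec (v1 v2 : 'cV[C]_n) :
  toC tau *: (tensmx 1%:M (toCmx K) *m block_vec v1 v2) =
  block_vec (toCmx M *m (Z *m v1)) (toCmx M *m (Z *m v2)).
Proof.
rewrite mx2_scalar1 tensmx_mx2_block_vec !scale1r !scale0r addr0 add0r block_vecZ.
by rewrite !mulmxA !mulM_Ztau !scalemxAl.
Qed.

Lemma calA_block_vec (v1 v2 : 'cV[C]_n) :
  toCmx (calA tau K M) *m block_vec v1 v2 =
  block_vec (toCmx M *m (3 / 2 *: v1 + 1 / 2 *: v2 + Z *m v1))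
            (toCmx M *m (- (9 / 2) *: v1 + 5 / 2 *: v2 + Z *m v2)).
Proof.
rewrite /calA (invmx_radauA2 R).2 radauL2U2 map_mxD map_mxZ !map_mxT.
rewrite map_mx2 map_mx1/=.
rewrite mulmxDl -scalemxAl tau_tensmx_block_vec tensmx_mx2_block_vec block_vecD.
by rewrite ![toCmx M *m (_ + Z *m _)]mulmxDr !toC_radau_coeffs.
Qed.

Lemma calPL_block_vec (v1 v2 : 'cV[C]_n) :
  toCmx (calPL tau K M) *m block_vec v1 v2 =
  block_vec (toCmx M *m (3 / 2 *: v1 + Z *m v1))
            (toCmx M *m (- (9 / 2) *: v1 + 4 *: v2 + Z *m v2)).
Proof.
rewrite /calPL map_mxD map_mxZ !map_mxT map_mx2 map_mx1/=.
rewrite mulmxDl -scalemxAl tau_tensmx_block_vec tensmx_mx2_block_vec block_vecD.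
rewrite ![toCmx M *m (_ + Z *m _)]mulmxDr !toC_radau_coeffs.
by rewrite rmorph0 scale0r addr0.
Qed.

Lemma Ztau_no_npos_eigenvalue (a : R) (v : 'cV[C]_n) :
  a <= 0 -> Z *m v = toC a *: v -> v = 0.
Proof.
move=> a0 Zv; apply/eqP; apply: contraT => v0.
have /Ztau_eigenvalue_real_gt0 : is_eigenvalue Z (toC a) by exists v.
by rewrite ltNge a0.
Qed.

(** Forward substitution: a kernel vector satisfies [Z v1 = - (3 / 2) v1], then [Z v2 = - 4 v2],
    while [Z] has only positive eigenvalues. *)
Lemma calPL_unitmx : calPL tau K M \in unitmx.
Proof.
rewrite -(map_unitmx toC); apply: unitmx_ker0 => x.
have [v1 [v2 ->]] := block_vec_surj x.
rewrite calPL_block_vec -block_vec0 => /block_vec_inj[].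
move=> /(canRL (mulKmx uMC)) + /(canRL (mulKmx uMC)); rewrite mulmx0.
move=> e1 e2.
have v10 : v1 = 0.
  apply: (@Ztau_no_npos_eigenvalue (- (3 / 2))); first by lra.
  rewrite rmorphN/= toC_radau_coeffs scaleNr.
  by apply/eqP; rewrite -addr_eq0 addrC e1.
move: e2; rewrite v10 scaler0 add0r => e2; congr block_vec.
apply: (@Ztau_no_npos_eigenvalue (- 4)); first by lra.
rewrite rmorphN/= toC_radau_coeffs scaleNr.
by apply/eqP; rewrite -addr_eq0 addrC e2.
Qed.

(** Moving [calPL] to the other side and cancelling [M] avoids any formula for the inverse of
    [calPL]. *)
Lemma prec_block_vecP (v1 v2 w1 w2 : 'cV[C]_n) :
  PA *m block_vec v1 v2 = block_vec w1 w2 <->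
  3 / 2 *: v1 + 1 / 2 *: v2 + Z *m v1 = 3 / 2 *: w1 + Z *m w1 /\
  - (9 / 2) *: v1 + 5 / 2 *: v2 + Z *m v2 =
    - (9 / 2) *: w1 + 4 *: w2 + Z *m w2.
Proof.
have uPL : toCmx (calPL tau K M) \in unitmx by rewrite map_unitmx calPL_unitmx.
rewrite /prec map_mxM map_invmx -mulmxA calA_block_vec.
have -> (x y : 'cV[C]_(2 * n)) : (invmx (toCmx (calPL tau K M)) *m x = y) <->
    (x = toCmx (calPL tau K M) *m y).
  by split=> [<-|->]; rewrite ?mulKVmx ?mulKmx.
rewrite calPL_block_vec; split=> [/block_vec_inj[]|[e1 e2]]; last first.
  exact: (congr2 (fun x y => block_vec (toCmx M *m x) (toCmx M *m y)) e1 e2).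
by move=> /(can_inj (mulKmx uMC)) ? /(can_inj (mulKmx uMC)).
Qed.

Lemma prec_eigenP (t : C) (v1 v2 : 'cV[C]_n) : t != 0 ->
  PA *m block_vec v1 v2 = (1 - t) *: block_vec v1 v2 <->
  3 *: (Z *m v1) + 4 *: v2 + Z *m v2 = 0 /\
  v2 = (- 2 * t) *: (3 / 2 *: v1 + Z *m v1).
Proof.
move=> t0; rewrite block_vecZ prec_block_vecP -radau_eqsP//.
have ZZ x : Z *m ((1 - t) *: x) = (1 - t) *: (Z *m x) by rewrite scalemxAr.
by rewrite !ZZ ![_ *: ((1 - t) *: _)]scaleC ![(1 - t) *: (_ + _)]scalerDr.
Qed.

Lemma toC_f2 mu : toC (f2 mu) = - (4 * (toC mu)^-1 + 2 / 3 * toC mu + 11 / 3)^-1.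
Proof.
by rewrite /f2 rmorphN fmorphV !rmorphD !rmorphM /= !fmorphV !rmorph_nat.
Qed.

(** * Eigenvalues other than 1 *)

Section NonunitEigenvalue.
Variable t : C.
Hypothesis t0 : t != 0.

(** A zero second block forces [Z v = 0] and then [- 3 t v = 0]. Hence the second block of an
    eigenvector determines the first. *)
Lemma prec_eigen_block0 (v : 'cV[C]_n) :
  PA *m block_vec v 0 = (1 - t) *: block_vec v 0 -> v = 0.
Proof.
move=> /(prec_eigenP _ _ t0)[]; rewrite scaler0 mulmx0 !addr0 => /eqP.
rewrite scaler_eq0 pnatr_eq0/= => /eqP -> /esym/eqP.
rewrite addr0 scalerA scaler_eq0 => /orP[|/eqP//].
by rewrite !mulf_eq0 oppr_eq0 invr_eq0 !pnatr_eq0/= (negPf t0).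
Qed.

Lemma prec_eigen_block_inj (v w x : 'cV[C]_n) :
  PA *m block_vec v x = (1 - t) *: block_vec v x ->
  PA *m block_vec w x = (1 - t) *: block_vec w x -> v = w.
Proof.
move=> ev ew; apply/eqP; rewrite -subr_eq0; apply/eqP/prec_eigen_block0.
have -> : block_vec (v - w) 0 = block_vec v x - block_vec w x.
  by rewrite -[- block_vec w x]scaleN1r block_vecZ block_vecD !scaleN1r subrr.
by rewrite mulmxBr ev ew scalerBr.
Qed.

Lemma prec_eigen_Ztau (v1 v2 : 'cV[C]_n) :
  eigenvector PA (1 - t) (block_vec v1 v2) ->
  v2 != 0 /\
  Z *m (Z *m v2) = (3 / (2 * t) - 11 / 2) *: (Z *m v2) - 6 *: v2.
Proof.
move=> [v0 PAv]; split.
  apply: contraNneq v0 => v20; move: PAv; rewrite v20 => /prec_eigen_block0 ->.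
  by rewrite block_vec0.
by have /(prec_eigenP _ _ t0)[] := PAv; exact: radau_quadratic.
Qed.

End NonunitEigenvalue.

(** The hypothesis on [v] is [(Z - a) (Z - b) v = 0]. *)
Lemma mulmx_root_split (s a b : C) (v : 'cV[C]_n) : a + b = s -> a * b = 6 ->
  Z *m (Z *m v) = s *: (Z *m v) - 6 *: v ->
  Z *m (Z *m v - b *: v) = a *: (Z *m v - b *: v).
Proof.
move=> <- <- ZZv; rewrite mulmxBr ZZv -scalemxAr scalerBr scalerA scalerDl.
by rewrite addrAC addrK.
Qed.

Lemma prec_eigenvalueP (lam : C) : lam != 1 -> is_eigenvalue PA lam ->
  exists2 mu : R, is_eigenvalue Z (toC mu) & lam = toC (1 + f2 mu).
Proof.
move=> lam1 [x]; have [v1 [v2 ->]] := block_vec_surj x.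
pose t := 1 - lam; have t0 : t != 0 by rewrite subr_eq0 eq_sym.
have -> : lam = 1 - t by rewrite subKr.
move=> /(prec_eigen_Ztau t0)[v20]; set s := 3 / _ - _ => ZZ.
(* The roots [a] and [b] of [X^2 - s X + 6] are taken over the complex numbers, since nothing is
   known yet about the sign of the discriminant. *)
pose r := sqrtC (s ^+ 2 - 24).
have rE : r ^+ 2 = s ^+ 2 - 24 by rewrite sqrtCK.
pose a := (s + r) / 2; pose b := (s - r) / 2.
have abs : a + b = s by rewrite /a /b; field.
have ab6 : a * b = 6 by rewrite /a /b; field: rE.
(* Either [v2] is an eigenvector for [b], or the nonzero vector [(Z - b) v2] is one for [a]. *)
have [nu Znu nuE] : exists2 nu, is_eigenvalue Z nu & nu ^+ 2 - s * nu + 6 = 0.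
  have [u0|u0] := eqVneq (Z *m v2 - b *: v2) 0.
    exists b; last by rewrite -abs -ab6; ring.
    by exists v2; split=> //; apply/eqP; rewrite -subr_eq0 u0.
  exists a; last by rewrite -abs -ab6; ring.
  by exists (Z *m v2 - b *: v2); split=> //; exact: mulmx_root_split abs ab6 ZZ.
have [mu mu0 muE] := Ztau_eigenvalue_gt0 Znu; rewrite muE in Znu nuE.
exists mu => //; rewrite rmorphD rmorph1 /= toC_f2; congr (1 - _).
have m0 : toC mu != 0 by rewrite fmorph_eq0 gt_eqF.
rewrite -[LHS]invrK; congr (_^-1).
move: nuE m0; rewrite /s; move: (toC mu) => m nuE m0.
(* Dividing the quadratic by [m] gives [s = m + 6 / m], and [t^-1 = 2 / 3 * s + 11 / 3]. *)
apply: (eq_lincomb (c1 := - (2 / (3 * m))) (c2 := 0) (c3 := 0) nuE nuE nuE).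
by field; rewrite t0.
Qed.

(** * Eigenvectors for the eigenvalues [1 + f2 mu] *)

Section RealEigenvalue.
Variable mu : R.
Hypothesis mu_gt0 : 0 < mu.

Let m0 : toC mu != 0. Proof. by rewrite fmorph_eq0 gt_eqF. Qed.

(** The double sign exhibits the form [1 - t] with [t = - f2 mu]. *)
Lemma toC_one_plus_f2 : toC (1 + f2 mu) = 1 - - toC (f2 mu).
Proof. by rewrite opprK rmorphD rmorph1. Qed.

Lemma toC_Nf2_neq0 : - toC (f2 mu) != 0.
Proof. by rewrite oppr_eq0 fmorph_eq0 lt_eqF// f2_lt0. Qed.

Lemma toC_Nf2V : (- toC (f2 mu))^-1 = 4 * (toC mu)^-1 + 2 / 3 * toC mu + 11 / 3.
Proof. by rewrite toC_f2 opprK invrK. Qed.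

Lemma radau_vec_eigen (v : 'cV[C]_n) : Z *m v = toC mu *: v ->
  PA *m radau_vec mu v = toC (1 + f2 mu) *: radau_vec mu v.
Proof.
move=> Zv; rewrite toC_one_plus_f2 /radau_vec.
apply/(prec_eigenP _ _ toC_Nf2_neq0).
have -> : toC (- (1 / 3) * (1 + 4 * mu^-1)) = - (1 / 3) * (1 + 4 * (toC mu)^-1).
  rewrite rmorphM rmorphN rmorphM rmorphD rmorphM /= !fmorphV.
  by rewrite !rmorph_nat !rmorph1.
have /= := radau_eqs_eigenvector v toC_Nf2_neq0 m0 toC_Nf2V.
set u := (_ * _) *: v => eqs.
have Zu : Z *m u = toC mu *: u by rewrite /u -scalemxAr Zv scaleC.
by rewrite Zu Zv.
Qed.

(** The involution [mu -> 6 / mu] exchanges the terms [4 * mu^-1] and [2 / 3 * mu]. *)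
Lemma f2_conjugate : f2 (6 / mu) = f2 mu.
Proof.
by rewrite /f2; congr (- _^-1); field; rewrite gt_eqF.
Qed.

(* [3 / (2 t) - 11 / 2 = mu + 6 / mu] for [t = - f2 mu], so that [v2] is killed
   by [(Z - mu) (Z - 6 / mu)], whose two roots are the preimages of [f2 mu]. *)
Lemma Ztau_decomposition (v : 'cV[C]_n) :
  Z *m (Z *m v) = (3 / (2 * - toC (f2 mu)) - 11 / 2) *: (Z *m v) - 6 *: v ->
  exists (s : seq R) (w : R -> 'cV[C]_n),
    [/\ uniq s, forall nu, nu \in s ->
          f2 nu = f2 mu /\ eigenvector Z (toC nu) (w nu)
      & v = \sum_(nu <- s) w nu].
Proof.
have sE : toC mu + toC (6 / mu) = 3 / (2 * - toC (f2 mu)) - 11 / 2.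
  rewrite invfM toC_Nf2V rmorphM /= fmorphV rmorph_nat; field; exact: m0.
have pE : toC mu * toC (6 / mu) = 6.
  by rewrite -rmorphM mulrC divfK ?rmorph_nat// gt_eqF.
move=> ZZ.
pose w1 := Z *m v - toC (6 / mu) *: v; pose w2 := Z *m v - toC mu *: v.
have Zw1 : Z *m w1 = toC mu *: w1 := mulmx_root_split sE pE ZZ.
have Zw2 : Z *m w2 = toC (6 / mu) *: w2.
  apply: (mulmx_root_split _ _ ZZ); first by rewrite addrC; exact: sE.
  by rewrite mulrC; exact: pE.
(* At a double root [w2] is an eigenvector or zero, and lies in the image of [Z - mu];
   semisimplicity makes it zero. *)
have [muE|mu_neq] := eqVneq (6 / mu) mu.
  have w20 : w2 = 0 by apply: Ztau_semisimple; rewrite -/w2 -{1}muE.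
  have Zv : Z *m v = toC mu *: v by apply/eqP; rewrite -subr_eq0 -/w2 w20.
  have [->|v0] := eqVneq v 0; first by exists [::], (fun=> 0); rewrite big_nil.
  exists [:: mu], (fun=> v); split=> //; last by rewrite big_seq1.
  by move=> nu; rewrite inE => /eqP->.
pose d := toC mu - toC (6 / mu).
have d0 : d != 0 by rewrite subr_eq0 eq_sym (inj_eq (@complexI R)).
(* The components come from [w1 - w2 = d v]. *)
pose w nu := if nu == mu then d^-1 *: w1 else - d^-1 *: w2.
(* Zero components are dropped because eigenvectors must be nonzero; one of the two roots may fail
   to be an eigenvalue of [Z]. *)
pose s := [seq nu <- [:: mu; 6 / mu] | w nu != 0].
have wmu : w mu = d^-1 *: w1 := ifT _ _ (eqxx mu).
have w6 : w (6 / mu) = - d^-1 *: w2 := ifN _ _ mu_neq.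
exists s, w; split.
- by rewrite filter_uniq//= inE eq_sym mu_neq.
- move=> nu; rewrite mem_filter !inE => /andP[wnu0 /orP[]/eqP nuE];
    rewrite nuE in wnu0 *; split; rewrite ?f2_conjugate//; split=> //.
    by rewrite wmu -scalemxAr Zw1 scaleC.
  by rewrite w6 -scalemxAr Zw2 scaleC.
- rewrite big_filter big_mkcond/= !big_cons big_nil addr0.
  rewrite !(fun x => if_neg (x == 0)).
  have ifE (x : 'cV[C]_n) : (if x == 0 then 0 else x) = x by case: eqP.
  rewrite !ifE wmu w6 scaleNr -scalerBr /w1 /w2 opprB addrC addrA subrK.
  by rewrite -scalerBl scalerA mulVf// scale1r.
Qed.

(** The first block may stay anonymous: it is later identified through the second one. *)
Lemma radau_vec_sum (s : seq R) (w : R -> 'cV[C]_n) :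
  exists u, \sum_(nu <- s) radau_vec nu (w nu) =
            block_vec u (\sum_(nu <- s) w nu).
Proof.
elim: s => [|nu s [u IH]]; first by exists 0; rewrite !big_nil block_vec0.
by rewrite !big_cons IH /radau_vec block_vecD; eexists.
Qed.

End RealEigenvalue.

(** Lifting the components of the second block by [radau_vec] gives vectors for one common
    eigenvalue, whose sum has the same second block as [x] and therefore equals [x]. *)
Lemma prec_eigenvector_decomposition mu (x : 'cV[C]_(2 * n)) : 0 < mu ->
  eigenvector PA (toC (1 + f2 mu)) x ->
  exists (s : seq R) (w : R -> 'cV[C]_n),
    [/\ uniq s, forall nu, nu \in s ->
          f2 nu = f2 mu /\ eigenvector Z (toC nu) (w nu)
      & x = \sum_(nu <- s) radau_vec nu (w nu)].
Proof.
move=> mu0; have [v1 [v2 ->]] := block_vec_surj x.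
rewrite toC_one_plus_f2 => ev.
have [v20 /(Ztau_decomposition mu0)[s [w [us sw v2E]]]] :=
  prec_eigen_Ztau (toC_Nf2_neq0 mu0) ev.
exists s, w; split=> //; have [u uE] := radau_vec_sum s w.
rewrite uE -v2E; congr block_vec.
apply: (prec_eigen_block_inj (toC_Nf2_neq0 mu0) ev.2).
rewrite v2E -uE mulmx_sumr scaler_sumr big_seq [RHS]big_seq.
apply: eq_bigr => nu /sw[fnu enu]; rewrite -toC_one_plus_f2 -fnu.
apply: radau_vec_eigen enu.2; apply: Ztau_eigenvalue_real_gt0.
by exists (w nu).
Qed.

(** All indices of the decomposition equal [mu]; uniqueness allows at most one, and [x != 0] at
    least one. *)
Lemma prec_eigenvector_unique mu (x : 'cV[C]_(2 * n)) : 0 < mu ->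
  (forall nu, is_eigenvalue Z (toC nu) -> f2 nu = f2 mu -> nu = mu) ->
  eigenvector PA (toC (1 + f2 mu)) x ->
  exists2 v, eigenvector Z (toC mu) v & x = radau_vec mu v.
Proof.
move=> mu0 mu_uniq ex.
have [s [w [us sw xE]]] := prec_eigenvector_decomposition mu0 ex.
have smu nu : nu \in s -> nu = mu.
  by move=> /sw[fnu enu]; apply: mu_uniq fnu; exists (w nu).
case: s us sw xE smu => [|nu s] us sw xE smu.
  by case: ex; rewrite xE big_nil eqxx.
have nuE := smu _ (mem_head _ _); rewrite {}nuE in us sw xE smu.
case: s us sw xE smu => [|nu' s] us sw xE smu.
  by exists (w mu); [case: (sw _ (mem_head _ _)) | rewrite xE big_seq1].
by move: us; rewrite /= (smu nu') !inE eqxx ?orbT.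
Qed.

(** * The eigenvalue 1 *)

(** The first block equation collapses to [1 / 2 *: v2 = 0], after which the second one holds
    trivially. *)
Lemma prec_eigen1P (x : 'cV[C]_(2 * n)) :
  PA *m x = x <-> exists v, x = block_vec v 0.
Proof.
have [v1 [v2 ->]] := block_vec_surj x; rewrite prec_block_vecP.
split=> [[e _]|[v /block_vec_inj[_ ->]]].
  exists v1; congr block_vec; apply/eqP; move: e => /addIr.
  rewrite -[RHS]addr0 => /addrI/eqP; rewrite scaler_eq0 mul1r invr_eq0.
  by rewrite pnatr_eq0.
by rewrite !scaler0 !mulmx0 !addr0.
Qed.

Lemma prec_eigenvector1 (x : 'cV[C]_(2 * n)) :
  eigenvector PA 1 x <-> exists2 v, v != 0 & x = block_vec v 0.
Proof.
rewrite /eigenvector scale1r prec_eigen1P; split.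
  move=> [x0 [v vE]]; exists v => //; apply: contraNneq x0 => v0.
  by rewrite vE v0 block_vec0.
move=> [v v0 ->]; split; last by exists v.
by rewrite block_vec_eq0 eqxx andbT.
Qed.

Lemma prec_alg_mult1 : alg_mult PA 1 = n.
Proof.
apply: alg_mult_block_vec => [v|u v].
  by rewrite scale1r; apply/prec_eigen1P; exists v.
rewrite scale1r => /prec_block_vecP; rewrite !scaler0 !mulmx0 add0r addr0.
move=> [e1 e2].
(* The second equation gives [v = 3 u], which turns the first into [Z u = 0]; 0 is not an eigenvalue
   of [Z]. *)
have Zu : Z *m u = 0.
  move: e1 e2; move: (Z *m u) (Z *m v) => z1 z2 /colP e1 /colP e2.
  apply/colP => i; move: {e1 e2}(e1 i) (e2 i); rewrite !mxE.
  move: (u i 0) (v i 0) (z1 i 0) (z2 i 0) => a b c d e1 e2.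
  by apply: (eq_lincomb (c1 := -1) (c2 := - (1 / 3)) (c3 := 0) e1 e2 e1); field.
have u0 : u = 0.
  by apply: (@Ztau_no_npos_eigenvalue 0) => //; rewrite Zu scale0r.
move: e1; rewrite u0 mulmx0 scaler0 !addr0 => /eqP.
by rewrite scaler_eq0 mul1r invr_eq0 pnatr_eq0 => /eqP.
Qed.

Lemma prec_geo_mult1 : geo_mult PA 1 = n.
Proof.
by apply: geo_mult_block_vec => x; rewrite scale1r; exact: prec_eigen1P.
Qed.

End Radau.

Theorem theorem2 (R : realType) (n : nat) (tau : R) (K M : 'M[R]_n)
    (hn : (1 <= n)%N) (htau : 0 < tau)
    (hK : sym_posdef K) (hM : sym_posdef M) :
  let toC := real_complex R in
  let PA := prec tau K M in
  let Z := Ztau tau K M in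
  (* the inverses occurring in PA and Z are genuine inverses *)
  [/\ M \in unitmx & calPL tau K M \in unitmx] /\
  (* 1 *)
  [/\ is_eigenvalue PA 1, alg_mult PA 1 = n & geo_mult PA 1 = n] /\
  (* 2: the eigenvalues of Z lie in the domain of f2 *)
  (forall mu : R[i], is_eigenvalue Z mu -> exists2 m : R, 0 < m & mu = toC m) /\
  (forall lam : R[i], lam != 1 ->
     (is_eigenvalue PA lam <->
      exists2 mu : R, is_eigenvalue Z (toC mu) & lam = toC (1 + f2 mu))) /\
  (forall mu : R, is_eigenvalue Z (toC mu) ->
     toC (1 + f2 mu) != 1 /\ 1 - r2star R <= 1 + f2 mu < 1) /\
  [/\ @f2 R @` `]0, +oo[%classic = `[- r2star R, 0[%classic,
      (exists2 mu : R, 0 < mu & f2 mu = - r2star R) /\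
      (forall mu : R, 0 < mu -> - r2star R <= f2 mu),
      f2 mu @[mu --> (0 : R)^'+] --> (0 : R)^'-
    & f2 mu @[mu --> +oo%R] --> (0 : R)^'- ] /\
  (* 3 *)
  (forall v : 'cV[R[i]]_(2 * n),
     eigenvector PA 1 v <->
     exists2 v1 : 'cV[R[i]]_n, v1 != 0 & v = block_vec v1 0) /\
  (forall (mu : R) (v2 : 'cV[R[i]]_n), eigenvector Z (toC mu) v2 ->
     eigenvector PA (toC (1 + f2 mu)) (radau_vec mu v2)) /\
  (* conversely, when mu is the only eigenvalue of Z with the value f2 mu *)
  (forall mu : R, is_eigenvalue Z (toC mu) ->
     (forall nu : R, is_eigenvalue Z (toC nu) -> f2 nu = f2 mu -> nu = mu) ->
     forall v : 'cV[R[i]]_(2 * n), eigenvector PA (toC (1 + f2 mu)) v ->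
     exists2 v2 : 'cV[R[i]]_n,
       eigenvector Z (toC mu) v2 & v = radau_vec mu v2) /\
  (* and, without that restriction, up to sums over the eigenvalues of Z with
     the same value of f2 *)
  (forall mu : R, is_eigenvalue Z (toC mu) ->
     forall v : 'cV[R[i]]_(2 * n), eigenvector PA (toC (1 + f2 mu)) v ->
     exists (s : seq R) (w : R -> 'cV[R[i]]_n),
       [/\ uniq s,
           forall nu : R, nu \in s ->
             f2 nu = f2 mu /\ eigenvector Z (toC nu) (w nu)
         & v = \sum_(nu <- s) radau_vec nu (w nu)]).
Proof.
move=> toC PA Z.
have gt0 mu : is_eigenvalue Z (toC mu) -> 0 < mu.
  exact: (Ztau_eigenvalue_real_gt0 htau hK hM).
have radau mu v : eigenvector Z (toC mu) v ->
    eigenvector PA (toC (1 + f2 mu)) (radau_vec mu v).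
  move=> ev; split; first by rewrite block_vec_eq0 (negPf ev.1) andbF.
  by apply: radau_vec_eigen ev.2 => //; apply: gt0; exists v.
split; first by split; [exact: posdef_unitmx | exact: calPL_unitmx].
split.
  split; [|exact: prec_alg_mult1|exact: prec_geo_mult1].
  (* The all-ones block is nonzero because [hn] provides an index. *)
  exists (block_vec (const_mx 1) 0); apply/prec_eigenvector1 => //.
  exists (const_mx 1) => //; apply/eqP => /colP/(_ (Ordinal hn)).
  by rewrite !mxE => /eqP; rewrite oner_eq0.
split; first by move=> mu; exact: Ztau_eigenvalue_gt0.
split.
  move=> lam lam1; split; first exact: prec_eigenvalueP.
  by move=> [mu [v /radau ev] ->]; exists (radau_vec mu v).
split.
  move=> mu /gt0 mu0; have fmu := f2_lt0 mu0; split.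
    by rewrite -(rmorph1 toC) (inj_eq (@complexI R)) -subr_eq0 addrC addKr lt_eqF.
  by rewrite lerD2l f2_ge// -ltrBrDl subrr.
split.
  split; [exact: image_f2| |exact: f2_cvg_right0|exact: f2_cvg_pinfty].
  split; last exact: f2_ge.
  by exists (Num.sqrt 6); [rewrite sqrtr_gt0 ltr0n | exact: f2_sqrt6].
split; first by move=> v; exact: prec_eigenvector1.
split; first exact: radau.
split=> mu /gt0 mu0; first by move=> ? ?; exact: prec_eigenvector_unique.
by move=> v; exact: prec_eigenvector_decomposition.
Qed.
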